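(* Let a random weighted iterated function system be given as in the context, with contraction factors $a_1(\omega),\dots,a_K(\omega)$, and let $D=\operatorname{ess\,sup}_{\omega\in\Omega_0} d_\omega$ and $d=\operatorname{ess\,inf}_{\omega\in\Omega_0} d_\omega$, where $d_\omega\ge 0$ is defined by $\sum_{j=1}^K a_j(\omega)^{d_\omega}=1$. Then there is a set $\Gamma\subset\Omega$ of full $\mathbb P$-measure such that $$\overline{\dim}_\Phi F_{\boldsymbol\omega}=D\quad\text{and}\quad \underline{\dim}_\Phi F_{\boldsymbol\omega}=d$$ for all $\boldsymbol\omega\in\Gamma$ and for all small dimension functions $\Phi$.
   Context: **Dimension functions.** A dimension function is a map $\Phi:(0,1)\to[0,\infty)$ such that $t^{1+\Phi(t)}$ decreases to $0$ as $t$ decreases to $0$. It is called small if (for $t$ near $0$) $\Phi(t)=H(t)\,\frac{\log|\log t|}{|\log t|}$ with $H(t)\to0$ as $t\to0$. **$\Phi$-dimensions of sets.** Let $X$ be a bounded metric space (here $X=[0,1]$), $B(x,R)$ the open ball with centre $x$ and radius $R$, and $N_r(E)$ the least number of open balls of radius $r$ needed to cover $E\subseteq X$. The upper $\Phi$-dimension $\overline{\dim}_\Phi E$ of a set $E\subseteq X$ is the infimum of all $d$ for which there are $C_1,C_2>0$ such that for all $0<r\le R^{1+\Phi(R)}<R<C_1$ and all $z\in E$, $N_r(B(z,R)\cap E)\le C_2(R/r)^d$. The lower $\Phi$-dimension $\underline{\dim}_\Phi E$ is the supremum of all $d$ for which there are $C_1,C_2>0$ such that for all such $r,R$ and all $z\in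 E$, $N_r(B(z,R)\cap E)\ge C_2(R/r)^d$. **Random weighted iterated function system.** Let $(\Omega_0,P)$ be a probability space, $K\ge2$ an integer, and $A,B,\tau>0$ constants with $0<KA\le B<1$ and $\tau\le(1-B)/K$. For each $\omega\in\Omega_0$, $\mathcal I_\omega=\{S_1(\omega),\dots,S_K(\omega)\}$ is an iterated function system of $K$ similarities mapping $[0,1]$ into itself; $S_j(\omega)$ has contraction factor $a_j(\omega)$ (a random variable), with $A\le a_j(\omega)\le\sum_{i=1}^K a_i(\omega)\le B$ for all $j,\omega$, and the distance between $S_i(\omega)[0,1]$ and $S_j(\omega)[0,1]$ is at least $\tau$ for all $i\ne j$ and all $\omega$. Each $\mathcal I_\omega$ comes with probability weights $p_1(\omega),\dots,p_K(\omega)\ge0$ (random variables) with $\sum_i p_i(\omega)=1$, such that for some $t>0$, $\mathbb E_\omega(p_i(\omega)^{-t})<\infty$ for each $i$ (the weights play no role in the definition of the random set). **Random set.** Let $\Omega=\Omega_0^{\mathbb N}$ with the infinite product measure $\mathbb P$. For $\boldsymbol\omega=(\boldsymbol\omega_1,\boldsymbol\omega_2,\dots)\in\Omega$ put $I_{i_1,\dots,i_n}(\boldsymbol\omega)=S_{i_1}(\boldsymbol\omega_1)\circ\cdots\circ S_{i_n}(\boldsymbol\omega_n)[0,1]$. The random Moran set is $F_{\boldsymbol\omega}=\bigcap_n\bigcup_{i_1,\dots,i_n\in\{1,\dots,K\}}I_{i_1,\dots,i_n}(\boldsymbol\omega)$. Essential suprema/infima over $\Omega_0$ are with respect to $P$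.
   Formalization: In the definition of the Φ-dimensions the scales satisfy r ≤ R^{1+Φ(R)} ≤ R < C_1 instead of R^{1+Φ(R)} < R, since with the strict inequality Φ = 0 admits no scales and the claim fails; for Φ > 0 near 0 nothing changes. *)

(* Defs.v *)
From HB Require Import structures.
From mathcomp Require Import all_boot all_order all_algebra.
From mathcomp Require Import all_classical all_reals all_analysis ess_sup_inf.
Set Implicit Arguments.
Unset Strict Implicit.
Unset Printing Implicit Defensive.
Import Order.TTheory GRing.Theory Num.Theory.
Import numFieldNormedType.Exports.
Local Open Scope classical_set_scope.
Local Open Scope ring_scope.

Section dimension_functions.
Context {R : realType}.
Implicit Types (Phi : R -> R) (E : set R).

(* Only the values of [Phi] on (0,1) are meaningful. *)
Definition dimension_function Phi : Prop :=
  [/\ {in `]0, 1[, forall t, 0 <= Phi t},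
      {in `]0, 1[ &, {homo (fun t => t `^ (1 + Phi t)) : s t / s <= t}} &
      t `^ (1 + Phi t) @[t --> 0^'+] --> 0].

Definition small_dimension_function Phi : Prop :=
  dimension_function Phi /\
  exists2 H : R -> R, H t @[t --> 0^'+] --> 0 &
    \forall t \near 0^'+, Phi t = H t * (ln `|ln t| / `|ln t|).

(* The ambient metric space is [0,1], so the centres of the balls lie in it. *)
Definition coverable (r : R) E (n : nat) : Prop :=
  exists c : 'I_n -> R,
    (forall i, c i \in `[0, 1]) /\ E `<=` \bigcup_i ball (c i) r.

Definition covering_number (r : R) E : \bar R :=
  ereal_inf [set n%:R%:E | n in coverable r E].

(* The scales r <= rho^(1+Phi(rho)) <= rho < C.  The middle inequality is not
   strict: it then holds automatically for rho in (0,1), and Phi = 0 gives the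
   Assouad dimensions, whereas with a strict inequality no pair (r, rho) would
   be admissible for Phi = 0. *)
Definition admissible_scales Phi (C r rho : R) : Prop :=
  (rho \in `]0, 1[) /\
  [/\ 0 < r, r <= rho `^ (1 + Phi rho), rho `^ (1 + Phi rho) <= rho & rho < C].

Definition upper_Phi_dim Phi E : \bar R :=
  ereal_inf [set s%:E | s in [set s : R | exists C1 C2 : R,
    [/\ 0 < C1, 0 < C2 &
      forall r rho z, admissible_scales Phi C1 r rho -> E z ->
        (covering_number r (ball z rho `&` E)
           <= (C2 * (rho / r) `^ s)%:E)%E]]].

Definition lower_Phi_dim Phi E : \bar R :=
  ereal_sup [set s%:E | s in [set s : R | exists C1 C2 : R,
    [/\ 0 < C1, 0 < C2 &
      forall r rho z, admissible_scales Phi C1 r rho -> E z ->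
        ((C2 * (rho / r) `^ s)%:E
           <= covering_number r (ball z rho `&` E))%E]]].

End dimension_functions.

Section random_moran_sets.
Context {R : realType} {d0 : measure_display} {Omega0 : measurableType d0}.
Variable P : probability Omega0 R.
Variable K : nat.

Definition set_distance (E F : set R) : R :=
  inf [set `|x - y| | x in E & y in F].

(* In [wifs_moment] the inverse is the one of [\bar R], for which 0^-1 = +oo:
   a weight may vanish, and then p^(-t) is infinite there. *)
Record random_weighted_ifs (A B tau : R) (S : Omega0 -> 'I_K -> R -> R)
    (a p : 'I_K -> {RV P >-> R}) : Prop := RandomWeightedIFS {
  wifs_self : forall w j, S w j @` `[0, 1] `<=` `[0, 1] ;
  wifs_similarity : forall w j, {in `[0, 1] &, forall x y,
    `|S w j x - S w j y| = a j w * `|x - y|} ;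
  wifs_lower : forall w j, A <= a j w ;
  wifs_sum : forall w j, a j w <= \sum_(i < K) a i w ;
  wifs_upper : forall w, \sum_(i < K) a i w <= B ;
  wifs_separated : forall w i j, i != j ->
    tau <= set_distance (S w i @` `[0, 1]) (S w j @` `[0, 1]) ;
  wifs_weight_ge0 : forall w i, 0 <= p i w ;
  wifs_weight_sum : forall w, \sum_(i < K) p i w = 1 ;
  wifs_moment : exists2 t : R, 0 < t &
    forall i, (\int[P]_w ((p i w `^ t)%:E)^-1 < +oo)%E }.

(* The number s >= 0 with a_1^s + ... + a_K^s = 1; it exists and is unique for
   K >= 2 numbers a_j in (0,1). *)
Definition similarity_dim (a : 'I_K -> R) : R :=
  xget 0 [set s | 0 <= s /\ \sum_(j < K) a j `^ s = 1].

(* Sequences are indexed from 0. *)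
Definition cylinders : set (set (nat -> Omega0)) :=
  [set C | exists (n : nat) (U : set Omega0),
    measurable U /\ C = [set w | U (w n)]].

(* [nat -> Omega0] with the product sigma-algebra. *)
Definition sequence_space := g_sigma_algebraType cylinders.

(* The finite-dimensional laws characterise the infinite product measure. *)
Definition is_infinite_product (PP : probability sequence_space R) : Prop :=
  forall (n : nat) (U : 'I_n -> set Omega0), (forall k, measurable (U k)) ->
    PP [set w : nat -> Omega0 | forall k : 'I_n, U k (w k)]
      = (\prod_(k < n) P (U k))%E.

Definition word_map (S : Omega0 -> 'I_K -> R -> R) (w : nat -> Omega0) (n : nat)
    (i : 'I_n -> 'I_K) : R -> R :=
  \big[(fun f g : R -> R => f \o g)/idfun]_(k < n) S (w k) (i k).

(* The term n = 0 is [0,1] and does not change the intersection. *)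
Definition moran_set (S : Omega0 -> 'I_K -> R -> R) (w : nat -> Omega0)
    : set R :=
  \bigcap_n \bigcup_(i : {ffun 'I_n -> 'I_K}) (word_map S w i @` `[0, 1]).

End random_moran_sets.

(* Main.v *)
Require Import Defs.
From HB Require Import structures.
From mathcomp Require Import all_boot all_order all_algebra.
From mathcomp Require Import all_classical all_reals all_analysis ess_sup_inf.
From mathcomp Require Import ring lra.
Set Implicit Arguments.
Unset Strict Implicit.
Unset Printing Implicit Defensive.
Import Order.TTheory GRing.Theory Num.Theory.
Import numFieldNormedType.Exports.
Local Open Scope classical_set_scope.
Local Open Scope ring_scope.

(** Write [U_q] for the set of parameters [v] with [1 <= sum_j a_j(v)^q], that is
    with similarity dimension at least [q], and [V_q] for the set where the sum is
    at most 1.  Let [r] be much smaller than [l], and consider the part of the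
    Moran set in a cylinder of length [l].  If the parameters that subdivide this
    cylinder down to scale [r] lie in [V_q], then about [(l / r)^q] balls of
    radius [r] suffice to cover it; if they lie in [U_q], then about [(l / r)^q]
    balls are necessary ([cylinder_coverable] and [cylinder_coverable_ge]).  Both
    bounds are self-reproducing under one subdivision, precisely because of the
    inequality satisfied by the sum of the [a_j^q].

    A ball of radius [rho] is squeezed between cylinders of comparable length,
    because cylinders shrink by bounded factors and are separated
    ([cylinder_at_scale]).  So if every parameter of a realisation lies in [V_q],
    its upper dimension is at most [q] for any [Phi], and if all of them lie in
    [U_q], its lower dimension is at least [q].  Almost surely this applies to
    every rational [q] beyond the essential bounds, which gives
    [upper <= ess_sup] and [lower >= ess_inf].

    For the converse inequalities let [q] be below the essential supremum, so
    that [U_q] has positive probability [p].  Among the first [(M+1)^L] blocks of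
    [L] consecutive times, a block all of whose parameters lie in [U_q] is missing
    with probability at most [exp(- ((M+1) p)^L)]; so almost surely there are such
    runs, of length [L] and starting at a time at most exponential in [L], for
    arbitrarily large [L] ([ae_log_runs]).  The cylinders where a run starts have
    length [rho] with [|log rho|] at most exponential in [L], hence
    [log |log rho| = O(L)], while the run resolves the scales from [rho] down to
    [rho B^L].  A small [Phi] only forbids the ratios [rho / r] below
    [|log rho|^H(rho)] with [H(rho) -> 0], which is less than [B^-L]: the run is
    visible to [Phi] ([run_scales_admissible]) and forces the upper dimension to
    be at least [q].  Runs in [V_q] bound the lower dimension from above in the
    same way.  The countably many rational [q] give one full-measure event, which
    serves all small [Phi] simultaneously. *)

(** * Coverings by balls *)

Section coverings.
Context {R : realType}.
Implicit Types (r : R) (E : set R).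

(** Lists of centres are easier to concatenate and to filter than families
    indexed by ordinals. *)
Lemma coverableP r E n :
  coverable r E n <-> exists s : seq R,
    [/\ size s = n, {in s, forall c, c \in `[0, 1]} &
        forall x, E x -> exists2 c, c \in s & ball c r x].
Proof.
split=> [[c [c01 cE]]|[s [<- s01 sE]]].
  exists [seq c i | i <- enum 'I_n]; split.
  - by rewrite size_map size_enum_ord.
  - by move=> _ /mapP[i _ ->].
  - move=> x /cE[i _ cx]; exists (c i) => //.
    by apply: map_f; rewrite mem_enum.
exists (tnth (in_tuple s)); split=> [i|x /sE[c cs cx]].
  by apply: s01; exact: mem_tnth.
have /tnthP[i ci] : c \in in_tuple s by [].
by exists i => //; rewrite -ci.
Qed.

Lemma coverableS r E E' n : E `<=` E' -> coverable r E' n -> coverable r E n.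
Proof.
by move=> EE' [c [c01 cE]]; exists c; split=> //; exact: subset_trans cE.
Qed.

Lemma coverable_ball r E (c : R) : c \in `[0, 1] -> E `<=` ball c r ->
  coverable r E 1.
Proof.
move=> c01 Ec; apply/coverableP; exists [:: c]; split=> //.
  by move=> y; rewrite inE => /eqP ->.
by move=> x /Ec cx; exists c; rewrite ?inE.
Qed.

Lemma coverable_bigcup (K : nat) r (E : 'I_K -> set R) (n : 'I_K -> nat) :
  (forall j, coverable r (E j) (n j)) ->
  coverable r (\bigcup_j E j) (\sum_j n j).
Proof.
move=> Ecov.
have /choice[s sP] : forall j, exists s : seq R,
    [/\ size s = n j, {in s, forall c, c \in `[0, 1]} &
        forall x, E j x -> exists2 c, c \in s & ball c r x].
  by move=> j; apply/coverableP.
apply/coverableP; exists (flatten [seq s j | j <- enum 'I_K]); split.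
- rewrite size_flatten /shape -map_comp sumnE big_map big_enum /=.
  by apply: eq_bigr => j _; have [] := sP j.
- move=> c /flattenP[_ /mapP[j _ ->] cj].
  by have [_ + _] := sP j; apply.
- move=> x [j _ Ejx]; have [_ _ /(_ x Ejx)[c cs cx]] := sP j.
  exists c => //; apply/flattenP; exists (s j) => //.
  by apply: map_f; rewrite mem_enum.
Qed.

Lemma coverable_gt0 r E n : E !=set0 -> coverable r E n -> (0 < n)%N.
Proof.
by move=> [x Ex] [c [_ /(_ x Ex)[i _ _]]]; exact: leq_trans (ltn_ord i).
Qed.

(** An open ball of radius [r] cannot meet two sets at distance [2r], so a
    cover of a union of separated sets splits into covers of the sets. *)
Lemma coverable_separated (K : nat) r (E : 'I_K -> set R) (E' : set R) N :
  (forall j, E j `<=` E') ->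
  (forall i j x y, i != j -> E i x -> E j y -> r *+ 2 <= `|x - y|) ->
  coverable r E' N ->
  exists n : 'I_K -> nat,
    (forall j, coverable r (E j) (n j)) /\ (\sum_j n j <= N)%N.
Proof.
move=> EE' sepE /coverableP[s [<- s01 sE]].
pose meets j (c : R) := `[< exists2 x, E j x & ball c r x >].
exists (fun j => count (meets j) s); split.
  move=> j; apply/coverableP; exists [seq c <- s | meets j c]; split.
  - by rewrite size_filter.
  - by move=> c; rewrite mem_filter => /andP[_]; exact: s01.
  - move=> x Ex; have [c cs cx] := sE _ (EE' _ _ Ex).
    by exists c => //; rewrite mem_filter cs andbT; apply/asboolP; exists x.
under eq_bigr do rewrite -sum1_count big_mkcond.
rewrite exchange_big/= -[leqRHS]sum1_size; apply: leq_sum => c _.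
have [j jc|none] := pickP (meets^~ c); last first.
  by rewrite big1// => j _; rewrite none.
rewrite (bigD1 j)//= jc big1 => [|i ij]//=; case: ifP => // /asboolP[x Eix cx].
move/asboolP : jc => [y Ejy cy].
have := sepE _ _ _ _ ij Eix Ejy; rewrite leNgt.
rewrite (le_lt_trans (ler_distD c _ _))// mulr2n ltrD//.
  by rewrite distrC.
Qed.

Lemma covering_number_le r E n : coverable r E n ->
  (covering_number r E <= n%:R%:E)%E.
Proof. by move=> rEn; apply: ereal_inf_lbound; exists n. Qed.

Lemma covering_number_ge r E (y : \bar R) :
  (forall n, coverable r E n -> (y <= n%:R%:E)%E) ->
  (y <= covering_number r E)%E.
Proof. by move=> yn; apply/ereal_infP => _ [n rEn <-]; exact: yn. Qed.

End coverings.

(** * The self-similar structure of the Moran set *)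

Section similarities.
Context {R : realType}.
Implicit Types (f g : R -> R) (l : R).

Definition similarity l f : Prop :=
  (forall x, x \in `[0, 1] -> f x \in `[0, 1]) /\
  {in `[0, 1] &, forall x y, `|f x - f y| = l * `|x - y|}.

Lemma similarity_id : similarity 1 idfun.
Proof. by split=> // x y _ _; rewrite mul1r. Qed.

Lemma similarity_comp l l' f g :
  similarity l f -> similarity l' g -> similarity (l * l') (f \o g).
Proof.
move=> [f01 lf] [g01 lg]; split=> [x /g01/f01//|x y x01 y01] /=.
by rewrite lf ?g01// lg// mulrA.
Qed.

Lemma dist01_le1 (x y : R) : x \in `[0, 1] -> y \in `[0, 1] -> `|x - y| <= 1.
Proof. by rewrite !in_itv/= => ? ?; rewrite ler_norml; apply/andP; split; lra. Qed.

Lemma similarity_closed l f : 0 < l -> similarity l f ->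
  closed (f @` `[0, 1]%classic).
Proof.
move=> l0 [_ lf]; apply: compact_closed; first exact: Rhausdorff.
apply: continuous_compact; last exact: segment_compact.
apply/subspace_continuousP => x x01; apply/cvgrPdist_lt => e e0.
rewrite near_withinE; near=> y => y01; rewrite lf ?inE// -ltr_pdivlMl//.
near: y; apply: nbhsx_ballx; by rewrite mulr_gt0// invr_gt0.
Unshelve. all: by end_near. Qed.

End similarities.

Section moran_structure.
Context {R : realType} {d0 : measure_display} {Omega0 : measurableType d0}.
Context {K : nat}.
Variables (A B tau : R) (S : Omega0 -> 'I_K -> R -> R) (a : 'I_K -> Omega0 -> R).
Implicit Types (w : nat -> Omega0).

(** The geometric content of the system.  The bounds [A <= 1/2] and [tau <= 1]
    are consequences of [K A <= B < 1] and [tau <= (1 - B) / K]. *)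
Record separated_ifs : Prop := SeparatedIFS {
  sep_K : (0 < K)%N ;
  sep_A : 0 < A ;
  sep_A2 : A <= 2^-1 ;
  sep_B : B < 1 ;
  sep_tau : 0 < tau ;
  sep_tau1 : tau <= 1 ;
  sep_sim : forall v j, similarity (a j v) (S v j) ;
  sep_lower : forall v j, A <= a j v ;
  sep_upper : forall v j, a j v <= B ;
  sep_dist : forall v i j x y, i != j -> x \in `[0, 1] -> y \in `[0, 1] ->
    tau <= `|S v i x - S v j y| }.

Hypothesis hS : separated_ifs.

Let A0 := sep_A hS.
Lemma sep_a_gt0 v j : 0 < a j v.
Proof. exact: lt_le_trans A0 (sep_lower hS v j). Qed.

Lemma sep_B_gt0 : 0 < B.
Proof.
have [v|none] := pselect (exists v : Omega0, True).
  case: v => v _; have := sep_upper hS v (Ordinal (sep_K hS)).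
  exact: lt_le_trans (sep_a_gt0 _ _).
by exfalso; apply: none; exists point.
Qed.

Definition stail w : nat -> Omega0 := fun k => w k.+1.

Lemma word_map_recl w n (i : 'I_n.+1 -> 'I_K) :
  word_map S w i =
  S (w 0%N) (i ord0) \o word_map S (stail w) (fun k => i (lift ord0 k)).
Proof. by rewrite /word_map big_ord_recl. Qed.

Lemma word_map0 w (i : 'I_0 -> 'I_K) : word_map S w i = idfun.
Proof. by rewrite /word_map big_ord0. Qed.

Lemma word_map_similarity w n (i : 'I_n -> 'I_K) :
  exists2 l, 0 < l & similarity l (word_map S w i).
Proof.
elim: n w i => [|n IH] w i.
  by rewrite word_map0; exists 1 => //; exact: similarity_id.
rewrite word_map_recl; have [l l0 ll] := IH (stail w) (fun k => i (lift ord0 k)).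
exists (a (i ord0) (w 0%N) * l); first by rewrite mulr_gt0// sep_a_gt0.
by apply: similarity_comp => //; exact: (sep_sim hS).
Qed.

Lemma moran_setP w x : moran_set S w x <->
  forall n, exists (i : 'I_n -> 'I_K) (y : R),
    y \in `[0, 1] /\ word_map S w i y = x.
Proof.
split=> [wx n|wx n _].
  by have [i _ [y y01 <-]] := wx n I; exists i, y.
have [i [y [y01 <-]]] := wx n; exists [ffun k => i k] => //; exists y => //.
by congr (word_map S w _ y); apply/funext => k; rewrite ffunE.
Qed.

Lemma moran_set01 w x : moran_set S w x -> x \in `[0, 1].
Proof. by move=> /moran_setP/(_ 0%N)[i [y [y01 <-]]]; rewrite word_map0. Qed.

(** Separation makes the first letter of a point of the Moran set the same in
    all generations, and injectivity makes its preimage the same. *)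
Lemma moran_set_rec w :
  moran_set S w = \bigcup_j (S (w 0%N) j @` moran_set S (stail w)).
Proof.
apply/seteqP; split=> [x /moran_setP wx|x [j _ [y /moran_setP wy <-]]].
  have [i1 [t1 [t101]]] := wx 1%N.
  rewrite word_map_recl/= word_map0 => x1.
  exists (i1 ord0) => //; exists t1 => //; apply/moran_setP => n.
  have [i [t [t01]]] := wx n.+1; rewrite word_map_recl/= => xn.
  set y := word_map _ _ _ _ in xn.
  have y01 : y \in `[0, 1].
    have [l _ [+ _]] := word_map_similarity (stail w) (fun k => i (lift ord0 k)).
    exact.
  have ij : i ord0 = i1 ord0.
    apply/eqP/negPn/negP => ij.
    have := sep_dist hS (w 0%N) ij y01 t101.
    by rewrite xn x1 subrr normr0 leNgt (sep_tau hS).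
  exists (fun k => i (lift ord0 k)), t; split=> //; rewrite -/y.
  have [_ /(_ y t1 y01 t101)] := sep_sim hS (w 0%N) (i ord0).
  rewrite xn ij x1 subrr normr0 => /esym/eqP.
  by rewrite mulf_eq0 gt_eqF ?sep_a_gt0//= normr_eq0 subr_eq0 => /eqP.
apply/moran_setP => -[|n].
  exists (fun=> j), (S (w 0%N) j y); rewrite word_map0; split=> //.
  by have [+ _] := sep_sim hS (w 0%N) j; apply; apply: moran_set01; apply/moran_setP.
have [i [t [t01 ty]]] := wy n.
exists (fun k => if unlift ord0 k is Some k' then i k' else j), t; split=> //.
rewrite word_map_recl/= unlift_none -ty; congr (S _ _ (word_map S _ _ t)).
by apply/funext => k; rewrite liftK.
Qed.

(** The intervals along a constant word are nested and compact; any cluster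
    point of the successive images of 0 lies in all of them. *)
Lemma moran_set_neq0 w : moran_set S w !=set0.
Proof.
pose j0 : 'I_K := Ordinal (sep_K hS).
pose u w n := word_map S w (fun _ : 'I_n => j0).
have nested n w' : u w' n.+1 @` `[0, 1]%classic `<=` u w' n @` `[0, 1].
  elim: n w' => [|n IH] w' x [t t01 <-]; rewrite /u word_map_recl/=.
    by rewrite !word_map0; eexists; last by []; have [+ _] := sep_sim hS (w' 0%N) j0; apply.
  have [|t' t'01 tt'] := IH (stail w') (u (stail w') n.+1 t); first by exists t.
  by exists t' => //; rewrite /u in tt'; rewrite word_map_recl/= tt'.
have nestedn n m : (n <= m)%N -> u w m @` `[0, 1]%classic `<=` u w n @` `[0, 1].
  elim: m => [|m IH]; first by rewrite leqn0 => /eqP ->.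
  rewrite leq_eqVlt => /predU1P[-> //|]; rewrite ltnS => /IH; apply: subset_trans.
  exact: nested.
have u01 n x : (u w n @` `[0, 1]%classic) x -> x \in `[0, 1].
  by move=> /(nestedn 0%N n (leq0n n))[t t01 <-]; rewrite /u word_map0.
have I0 : (0 : R) \in `[0, 1] by rewrite in_itv/= lexx ler01.
have [x [_ xcl]] : `[0, 1]%classic `&` cluster (u w n 0 @[n --> \oo]) !=set0.
  apply: (segment_compact (a := 0) (b := 1)); exists 0%N => // n _.
  by apply: (u01 n); exists 0.
exists x; apply/moran_setP => n.
have [l l0 ul] := word_map_similarity w (fun _ : 'I_n => j0).
have xI : closure (u w n @` `[0, 1]%classic) x.
  move=> V xV; apply: xcl => //.
  by exists n => // m nm; apply: (nestedn n m nm); exists 0.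
by have [t t01 tx] := similarity_closed l0 ul xI; exists (fun=> j0), t.
Qed.

End moran_structure.

(** * Counting balls inside one cylinder *)

Section counting.
Context {R : realType} {d0 : measure_display} {Omega0 : measurableType d0}.
Context {K : nat}.
Variables (A B tau : R) (S : Omega0 -> 'I_K -> R -> R) (a : 'I_K -> Omega0 -> R).
Hypothesis hS : separated_ifs A B tau S a.
Implicit Types (w : nat -> Omega0) (f : R -> R) (l r q : R).

Let A0 := sep_A hS.
Let a0 := sep_a_gt0 hS.

Lemma powR_ge1 (x q : R) : 1 <= x -> 0 <= q -> 1 <= x `^ q.
Proof. by move=> x1 q0; rewrite -(powRr0 x) ler_powR. Qed.

Lemma powR_le1 (x q : R) : 0 <= x <= 1 -> 0 <= q -> x `^ q <= 1.
Proof.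
move=> /andP[x0 x1] q0; have <- : 1 `^ q = 1 by rewrite powR1.
by apply: ge0_ler_powR; rewrite ?nnegrE.
Qed.

Lemma image_moran_rec f w :
  f @` moran_set S w =
  \bigcup_j ((f \o S (w 0%N) j) @` moran_set S (stail w)).
Proof.
rewrite (moran_set_rec hS) image_bigcup.
by apply: eq_bigcupr => j _; rewrite image_comp.
Qed.

Let one_ball_upper w q f l r : 0 <= q -> similarity l f -> 0 < r ->
  A * r <= l -> l < r ->
  exists n, coverable r (f @` moran_set S w) n /\ n%:R <= (l / (A * r)) `^ q.
Proof.
move=> q0 sf r0 Al lr; have Ar0 : 0 < A * r by rewrite mulr_gt0.
have [x0 /(moran_set01)x01] := moran_set_neq0 hS w.
exists 1%N; split; last by rewrite powR_ge1// ler_pdivlMr// mul1r.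
apply: (@coverable_ball _ _ _ (f x0)); first by apply: (proj1 sf).
move=> _ [y /moran_set01 y01 <-]; rewrite /ball/= (proj2 sf)//.
apply: le_lt_trans lr.
by rewrite ler_piMr ?dist01_le1// (le_trans _ Al)// ltW.
Qed.

Let one_ball_lower w q f l r n : 0 <= q -> 0 < l -> 0 < r ->
  tau * l <= r *+ 2 -> coverable r (f @` moran_set S w) n ->
  (tau * l / (r *+ 2)) `^ q <= n%:R.
Proof.
move=> q0 l0 r0 lr cov; apply: (@le_trans _ _ 1).
  apply: powR_le1 => //; rewrite ler_pdivrMr ?mulrn_wgt0// mul1r lr andbT.
  by rewrite divr_ge0 ?ltW ?mulrn_wgt0// mulr_gt0// (sep_tau hS).
rewrite ler1n; apply: coverable_gt0 cov.
by have [x wx] := moran_set_neq0 hS w; exists (f x), x.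
Qed.

(** If [sum_j a_j^q <= 1], the bound [(l / (A r))^q] dominates the sum of the
    bounds of the children, so it passes from children to parents; one ball
    suffices for an interval shorter than [r], and since the parent is at least
    [r] long the bound is then still at least 1. *)
Lemma cylinder_coverable q L w f l r : 0 <= q -> similarity l f -> 0 < r ->
  (forall k, (k < L)%N -> \sum_j a j (w k) `^ q <= 1) ->
  A * r <= l -> l * B ^+ L < r ->
  exists n, coverable r (f @` moran_set S w) n /\ n%:R <= (l / (A * r)) `^ q.
Proof.
move=> q0; elim: L w f l => [|L IH] w f l sf r0 wq Al lB.
  by rewrite mulr1 in lB; exact: one_ball_upper.
have [lr|rl] := ltP l r; first exact: one_ball_upper.
have Ar0 : 0 < A * r by rewrite mulr_gt0.
have l0 : 0 < l := lt_le_trans Ar0 Al.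
have step j : exists n, coverable r ((f \o S (w 0%N) j) @` moran_set S (stail w)) n
    /\ n%:R <= (l * a j (w 0%N) / (A * r)) `^ q.
  apply: IH => //.
  - by apply: similarity_comp => //; exact: (sep_sim hS).
  - by move=> k kL; exact: wq.
  - by rewrite mulrC ler_pM ?(ltW r0) ?(ltW A0)// (sep_lower hS).
  - apply: le_lt_trans lB; rewrite -mulrA ler_pM2l// exprS ler_wpM2r//.
      by rewrite exprn_ge0// ltW// (sep_B_gt0 hS).
    exact: (sep_upper hS).
have /choice[n nP] := step; exists (\sum_j n j)%N; split.
  rewrite image_moran_rec; apply: coverable_bigcup => j.
  by have [] := nP j.
rewrite natr_sum.
apply: (@le_trans _ _ (\sum_j (l / (A * r)) `^ q * a j (w 0%N) `^ q)).
  apply: ler_sum => j _; have [_ /le_trans] := nP j; apply.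
  by rewrite mulrAC [leLHS]powRM ?(ltW (a0 _ _)) ?(divr_ge0 (ltW l0) (ltW Ar0)).
by rewrite -mulr_sumr ler_piMr ?powR_ge0//; exact: wq.
Qed.

(** Pieces at distance at least [2r] are covered separately, so when
    [1 <= sum_j a_j^q] the bound [(tau l / (2r))^q] passes from children to
    parents; it is less than 1 once the gaps of the piece are below [2r]. *)
Lemma cylinder_coverable_ge q L w f l r n : 0 <= q -> similarity l f -> 0 < l -> 0 < r ->
  (forall k, (k < L)%N -> 1 <= \sum_j a j (w k) `^ q) ->
  tau * l * B ^+ L <= r *+ 2 ->
  coverable r (f @` moran_set S w) n ->
  (tau * l / (r *+ 2)) `^ q <= n%:R.
Proof.
move=> q0; elim: L w f l n => [|L IH] w f l n sf l0 r0 wq lB cov.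
  by rewrite mulr1 in lB; exact: one_ball_lower cov.
have [lr|rl] := leP (tau * l) (r *+ 2); first exact: one_ball_lower cov.
have r20 : 0 < r *+ 2 by rewrite mulrn_wgt0.
have tl0 : 0 < tau * l by rewrite mulr_gt0 ?(sep_tau hS).
have [||m [mcov mn]] := @coverable_separated _ K _
  (fun j => (f \o S (w 0%N) j) @` moran_set S (stail w)) _ _ _ _ cov.
- by rewrite image_moran_rec => j x jx; exists j.
- move=> i j _ _ ij [x /moran_set01 x01 <-] [y /moran_set01 y01 <-] /=.
  have S01 k z : z \in `[0, 1] -> S (w 0%N) k z \in `[0, 1].
    by move: z; exact: (proj1 (sep_sim hS (w 0%N) k)).
  rewrite (proj2 sf) ?S01//; apply: le_trans (ltW rl) _.
  by rewrite mulrC ler_pM2l// (sep_dist hS).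
rewrite -(ler_nat R) natr_sum in mn; apply: le_trans mn.
apply: (@le_trans _ _ (\sum_j (tau * l / (r *+ 2)) `^ q * a j (w 0%N) `^ q)).
  by rewrite -mulr_sumr ler_peMr ?powR_ge0//; exact: wq.
apply: ler_sum => j _; rewrite -powRM ?(divr_ge0 (ltW tl0) (ltW r20)) ?(ltW (a0 _ _))//.
rewrite mulrAC -(mulrA tau); apply: (IH _ (f \o S (w 0%N) j)) => //.
- by apply: similarity_comp => //; exact: (sep_sim hS).
- by rewrite mulr_gt0.
- by move=> k kL; exact: wq.
- apply: le_trans lB; rewrite -!mulrA ler_pM2l ?(sep_tau hS)// ler_pM2l//.
  rewrite exprS ler_wpM2r//.
    by rewrite exprn_ge0// ltW// (sep_B_gt0 hS).
  exact: (sep_upper hS).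
Qed.

End counting.

(** * Cylinders around a point *)

Section cylinders.
Context {R : realType} {d0 : measure_display} {Omega0 : measurableType d0}.
Context {K : nat}.
Variables (A B tau : R) (S : Omega0 -> 'I_K -> R -> R) (a : 'I_K -> Omega0 -> R).
Hypothesis hS : separated_ifs A B tau S a.
Implicit Types (w : nat -> Omega0) (f : R -> R) (l r q : R).

Definition sdrop n w : nat -> Omega0 := fun k => w (k + n)%N.

Lemma stail_sdrop n w : stail (sdrop n w) = sdrop n.+1 w.
Proof. by apply/funext => k; rewrite /stail /sdrop addSnnS. Qed.

(** The image by [f] of the Moran set of the shifted sequence is the part of the
    Moran set in a cylinder of generation [n] and length [l] that contains
    [z]; the last clause is the separation from the other cylinders. *)
Record cylinder_at w z n f l : Prop := CylinderAt {
  cyl_sim : similarity l f ;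
  cyl_ge : A ^+ n <= l ;
  cyl_le : l <= B ^+ n ;
  cyl_mem : (f @` moran_set S (sdrop n w)) z ;
  cyl_sub : f @` moran_set S (sdrop n w) `<=` moran_set S w ;
  cyl_isolated : forall x, moran_set S w x -> `|z - x| < tau * l ->
    (f @` moran_set S (sdrop n w)) x }.

Let A0 := sep_A hS.
Let B0 := sep_B_gt0 hS.

Lemma cylinder_gt0 w z n f l : cylinder_at w z n f l -> 0 < l.
Proof. by move=> /cyl_ge; apply: lt_le_trans; rewrite exprn_gt0. Qed.

Lemma cylinder0 w z : moran_set S w z -> cylinder_at w z 0 idfun 1.
Proof.
have E : sdrop 0 w = w by apply/funext => k; rewrite /sdrop addn0.
move=> wz; split; rewrite ?expr0 ?E ?image_id//; exact: similarity_id.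
Qed.

Lemma cylinderS w z n f l : cylinder_at w z n f l ->
  exists f' l', cylinder_at w z n.+1 f' l' /\ A * l <= l' <= l.
Proof.
move=> C; have l0 := cylinder_gt0 C.
have := cyl_mem C; rewrite (image_moran_rec hS) => -[j _ zj].
set v := sdrop n w 0%N in zj.
have sub : (f \o S v j) @` moran_set S (sdrop n.+1 w) `<=`
    f @` moran_set S (sdrop n w).
  by rewrite (image_moran_rec hS f) => x jx; exists j => //; rewrite stail_sdrop.
exists (f \o S v j), (l * a j v); split; last first.
  rewrite mulrC ler_pM2l// (sep_lower hS)/= ler_piMr ?(ltW l0)//.
  by rewrite (le_trans (sep_upper hS _ _))// ltW// (sep_B hS).
split.
- by apply: similarity_comp; [exact: cyl_sim C|exact: (sep_sim hS)].
- rewrite exprSr ler_pM ?exprn_ge0 ?(ltW A0)//; first exact: cyl_ge C.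
  exact: (sep_lower hS).
- rewrite exprSr ler_pM ?(ltW l0)//; first by rewrite ltW// (sep_a_gt0 hS).
    exact: cyl_le C.
  exact: (sep_upper hS).
- by rewrite -stail_sdrop.
- exact: subset_trans sub (cyl_sub C).
- move=> x wx zx.
  have av1 : a j v <= 1 by rewrite (le_trans (sep_upper hS _ _))// ltW// (sep_B hS).
  have := cyl_isolated C wx (lt_le_trans zx _).
  rewrite mulrA ler_piMr// ?mulr_ge0 ?(ltW l0) ?(ltW (sep_tau hS))// => /(_ isT).
  rewrite (image_moran_rec hS) => -[i _ xi].
  have [->|ij] := eqVneq j i; first by rewrite -stail_sdrop.
  exfalso; move: zj xi zx; rewrite -/v.
  move=> [y /moran_set01 y01 <-] [y' /moran_set01 y'01 <-] /=.
  have S01 k t : t \in `[0, 1] -> S v k t \in `[0, 1].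
    by move: t; exact: (proj1 (sep_sim hS v k)).
  rewrite (proj2 (cyl_sim C)) ?S01// ltNge => /negP; apply.
  apply: (@le_trans _ _ (l * tau)).
    by rewrite mulrCA ler_pM2l// ler_piMr// ltW// (sep_tau hS).
  by rewrite ler_pM2l// (sep_dist hS).
Qed.

Lemma cylinder_exists w z n : moran_set S w z -> exists f l, cylinder_at w z n f l.
Proof.
move=> wz; elim: n => [|n [f [l /cylinderS[f' [l' [C _]]]]]].
  by exists idfun, 1; exact: cylinder0.
by exists f', l'.
Qed.

Lemma expr_eventually_lt (x e : R) : 0 < x < 1 -> 0 < e ->
  exists n0, forall n, (n0 <= n)%N -> x ^+ n < e.
Proof.
move=> /andP[x0 x1] e0.
have := @cvg_expr R x; rewrite gtr0_norm// => /(_ x1)/cvgrPdist_lt/(_ _ e0).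
move=> [n0 _ H]; exists n0 => n /H/=.
by rewrite sub0r normrN gtr0_norm// exprn_gt0.
Qed.

(** Consecutive generations shrink by a factor at least [A], so some cylinder
    around [z] has length comparable to any prescribed scale. *)
Lemma cylinder_at_scale w z (theta : R) : moran_set S w z -> 0 < theta <= 1 ->
  exists n f l, [/\ cylinder_at w z n f l, A * theta <= l & l < theta].
Proof.
move=> wz /andP[th0 th1]; apply: contrapT => none.
have big n : exists f l, cylinder_at w z n f l /\ theta <= l.
  elim: n => [|n [f [l [C thl]]]].
    by exists idfun, 1; split=> //; exact: cylinder0.
  have [f' [l' [C' /andP[Al _]]]] := cylinderS C.
  exists f', l'; split=> //; rewrite leNgt; apply/negP => l'th.
  apply: none; exists n.+1, f', l'; split=> //; apply: le_trans Al.
  by rewrite ler_pM2l.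
have [||n0 /(_ n0 (leqnn _))] := @expr_eventually_lt B theta; rewrite ?B0 ?(sep_B hS)//.
have [f [l [C thl]]] := big n0.
by rewrite ltNge (le_trans thl (cyl_le C)).
Qed.

End cylinders.

(** * Admissible scales along logarithmic runs *)

Section scales.
Context {R : realType}.
Implicit Types (Phi : R -> R) (c s q x y : R).

Lemma at_right0P (P : R -> Prop) : (\forall t \near 0^'+, P t) ->
  exists2 e : R, 0 < e & forall t, 0 < t -> t < e -> P t.
Proof.
move=> [e /= e0 H]; exists e => // t t0 te; apply: H => //=.
by rewrite sub0r normrN gtr0_norm.
Qed.

Lemma expr_powR x n s : 0 < x -> (x ^+ n) `^ s = (x `^ s) ^+ n.
Proof.
move=> x0; rewrite -powR_mulrn ?ltW// -powRrM mulrC powRrM powR_mulrn//.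
exact: powR_ge0.
Qed.

(** With [X = x^-L], the larger exponent of [X] wins as [L] grows. *)
Lemma powR_growth x C c1 c2 s q : 0 < x < 1 -> 0 < C -> 0 < c1 -> 0 < c2 ->
  s < q -> exists L0, forall L, (L0 <= L)%N ->
    C * (c1 / x ^+ L) `^ s < (c2 / x ^+ L) `^ q.
Proof.
move=> /andP[x0 x1] C0 c10 c20 sq.
have y01 : 0 < x `^ (q - s) < 1.
  rewrite powR_gt0//= /powR gt_eqF// expR_lt1.
  by rewrite pmulr_rlt0 ?subr_gt0// ln_lt0// x0.
have e0 : 0 < c2 `^ q / (C * c1 `^ s).
  by rewrite divr_gt0 ?mulr_gt0 ?powR_gt0.
have [L0 HL] := expr_eventually_lt y01 e0; exists L0 => L /HL.
rewrite ltr_pdivlMr ?mulr_gt0 ?powR_gt0// -expr_powR// => lt1.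
have X0 : 0 < x ^+ L by rewrite exprn_gt0.
have E c t : 0 < c -> (c / x ^+ L) `^ t = c `^ t / (x ^+ L) `^ t.
  move=> c0; rewrite powRM ?invr_ge0 ?(ltW X0) ?(ltW c0)//.
  by rewrite -(powR_inv1 (ltW X0)) -powRrM mulN1r powRN.
rewrite !E// ltr_pdivlMr ?powR_gt0//; apply: le_lt_trans lt1.
rewrite powRD ?(gt_eqF X0) ?implybT// powRN.
by rewrite le_eqVlt; apply/orP; left; apply/eqP; ring.
Qed.

Lemma ln_poly_bound (c y : R) (M L n : nat) : 1 <= c -> (0 < L)%N ->
  1 <= y -> y <= c * n%:R -> (n <= M.+1 ^ L * L)%N ->
  0 <= ln y <= L%:R * (ln c + ln M.+1%:R + 1).
Proof.
move=> c1 L0 y1 yn nL; rewrite ln_ge0//=.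
have cM : y <= c * (M.+1%:R ^+ L * L%:R).
  apply: le_trans yn _; rewrite ler_pM2l ?(lt_le_trans ltr01)//.
  by rewrite -natrX -natrM ler_nat.
have L1 : 1 <= L%:R :> R by rewrite ler1n.
have c0 : 0 < c by rewrite (lt_le_trans ltr01).
have ML0 : 0 < M.+1%:R ^+ L :> R by rewrite exprn_gt0.
have Lr0 : 0 < L%:R :> R by rewrite ltr0n.
apply: (@le_trans _ _ (ln (c * (M.+1%:R ^+ L * L%:R)))).
  by rewrite ler_ln ?posrE// ?mulr_gt0// (lt_le_trans ltr01).
rewrite !lnM ?posrE ?mulr_gt0// lnXn// -mulr_natl.
have : ln c <= L%:R * ln c by rewrite ler_peMl// ln_ge0.
have := ltW (ln_sublinear Lr0).
lra.
Qed.

(** A length between [A^n] and [B^n] has [|log rho|] of order [n], and [n] is at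
    most exponential in [L], so [log |log rho| = O(L)].  Since
    [rho^Phi(rho) = exp(- H(rho) log |log rho|)] with [H -> 0], the factor
    [B^L] is eventually smaller than the one that [Phi] demands. *)
Lemma run_scales_admissible Phi (A B C1 c0 c1 : R) (M : nat) :
  small_dimension_function Phi -> 0 < A < 1 -> 0 < B < 1 ->
  0 < C1 -> 0 < c0 -> 0 < c1 ->
  exists L0, forall L n l, (L0 <= L)%N -> (L <= n)%N -> (n <= M.+1 ^ L * L)%N ->
    A ^+ n <= l <= B ^+ n ->
    admissible_scales Phi C1 (c1 * B ^+ L * (c0 * l)) (c0 * l).
Proof.
move=> [[Phi0 _ _] [H H0 /at_right0P[e1 e10 HPhi]]] /andP[A0 A1] /andP[B0 B1].
move=> C10 c00 c10.
pose c2 : R := 1 + `|ln c0| - ln A.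
have lnA : ln A < 0 by rewrite ln_lt0// A0.
have c21 : 1 <= c2 by rewrite /c2; have := normr_ge0 (ln c0); lra.
pose c3 : R := ln c2 + ln M.+1%:R + 1.
have c31 : 1 <= c3 by rewrite /c3 lerDr addr_ge0 ?ln_ge0// ler1n.
pose b := - ln B; have b0 : 0 < b by rewrite oppr_gt0 ln_lt0// B0.
have e0 : 0 < b / (c3 *+ 2) by rewrite divr_gt0// mulrn_wgt0// (lt_le_trans ltr01).
have [e2 e20 He] : exists2 e2 : R, 0 < e2 &
    forall t, 0 < t -> t < e2 -> `|H t| <= b / (c3 *+ 2).
  by apply: at_right0P; apply: cvgr0_norm_le H0 _ e0.
(* Below e * c0 the radius rho is in the range where H is small and Phi has its
   special form, is less than C1, and satisfies |ln rho| > 1, which makes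
   ln |ln rho| nonnegative. *)
pose e := Num.min (Num.min e1 e2) (Num.min C1 (expR (-1))) / c0.
have ee0 : 0 < e by rewrite divr_gt0// !lt_min e10 e20 C10 expR_gt0.
have B01 : 0 < B < 1 by rewrite B0.
have [L1 HL1] := expr_eventually_lt B01 ee0.
pose L2 := Num.bound (2 * `|ln c1| / b).
exists (maxn 1 (maxn L1 L2)) => L n l; rewrite !geq_max => /and3P[L0 LL1 LL2].
move=> Ln nL /andP[Al lB].
have l0 : 0 < l by rewrite (lt_le_trans _ Al)// exprn_gt0.
set rho := c0 * l; have rho0 : 0 < rho by rewrite mulr_gt0.
have : rho < e * c0.
  by rewrite (mulrC e) /rho ltr_pM2l// (le_lt_trans lB)// HL1// (leq_trans LL1).
rewrite mulfVK ?gt_eqF// !lt_min => /andP[/andP[rho1 rho2] /andP[rhoC rhoe]].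
have rhoL : ln rho < -1 by rewrite -[ltRHS]expRK ltr_ln// posrE ?expR_gt0.
have rho_lt1 : rho < 1 by rewrite -[ltRHS]expR0 (lt_trans rhoe)// ltr_expR ltrN10.
have rho01 : rho \in `]0, 1[ by rewrite in_itv/= rho0.
have pw : rho `^ (1 + Phi rho) = rho * rho `^ (Phi rho).
  by rewrite powRD ?(gt_eqF rho0) ?implybT// powRr1// ltW.
split=> //; split=> //.
- by rewrite !mulr_gt0// exprn_gt0.
- rewrite pw mulrC ler_pM2l// /powR gt_eqF//.
  rewrite -[leLHS]lnK ?posrE ?mulr_gt0 ?exprn_gt0// ler_expR.
  rewrite lnM ?posrE ?exprn_gt0// lnXn// HPhi//.
  set y := `|ln rho|.
  have yE : y = - ln rho by rewrite /y ltr0_norm//; lra.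
  have y1 : 1 <= y by rewrite yE; lra.
  have n1 : 1 <= n%:R :> R by rewrite ler1n (leq_trans L0).
  have yn : y <= c2 * n%:R.
    rewrite yE lnM ?posrE// /c2.
    have lA : ln A * n%:R <= ln l.
      by rewrite mulr_natr -lnXn// ler_ln ?posrE ?exprn_gt0.
    have : - ln c0 <= `|ln c0| by rewrite -normrN ler_norm.
    have : 0 <= `|ln c0| by [].
    nra.
  have /andP[ly0 lyL] := ln_poly_bound c21 L0 y1 yn nL.
  have Hy : H rho * ln y <= b * L%:R / 2.
    apply: (@le_trans _ _ (b / (c3 *+ 2) * (L%:R * c3))).
      apply: (@le_trans _ _ (b / (c3 *+ 2) * ln y)).
        by rewrite ler_wpM2r// (le_trans (ler_norm _))// He.
      by rewrite ler_pM2l.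
    rewrite le_eqVlt; apply/orP; left; apply/eqP; field.
    by rewrite gt_eqF// (lt_le_trans ltr01).
  have c1L : ln c1 <= b * L%:R / 2.
    have : 2 * `|ln c1| / b <= L%:R.
      apply: (@le_trans _ _ L2%:R); last by rewrite ler_nat.
      by rewrite ltW// archi_boundP// divr_ge0 ?mulr_ge0// ltW.
    rewrite ler_pdivrMr//; have := ler_norm (ln c1); lra.
  have -> : H rho * (ln y / y) * ln rho = - (H rho * ln y).
    have -> : ln rho = - y by rewrite yE opprK.
    by field; rewrite gt_eqF// (lt_le_trans ltr01).
  (* Half of b * L absorbs the constant c1, the other half absorbs Phi. *)
  rewrite -mulr_natr; have -> : ln B = - b by rewrite /b opprK.
  lra.
- rewrite pw ler_piMr ?(ltW rho0)//.
  rewrite -[leRHS](powRr0 rho); apply: ger_powR; first by rewrite rho0 ltW.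
  exact: Phi0.
Qed.

End scales.

(** * Dimensions of one realisation *)

Section realisations.
Context {R : realType} {d0 : measure_display} {Omega0 : measurableType d0}.
Context {K : nat}.
Variables (A B tau : R) (S : Omega0 -> 'I_K -> R -> R) (a : 'I_K -> Omega0 -> R).
Hypothesis hS : separated_ifs A B tau S a.
Implicit Types (w : nat -> Omega0) (Phi : R -> R) (q : R).

Let A0 := sep_A hS.
Let B0 := sep_B_gt0 hS.
Let tau0 := sep_tau hS.
Let A01 : 0 < A < 1.
Proof. by rewrite A0 (le_lt_trans (sep_A2 hS))// invf_lt1// ltr1n. Qed.
Let B01 : 0 < B < 1. Proof. by rewrite B0 (sep_B hS). Qed.

Definition power_sum q v : R := \sum_j a j v `^ q.

(** Runs of length [L] that start at a time at most exponential in [L], that is,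
    runs at [n] of length at least a constant multiple of [log n]. *)
Definition log_runs (U : set Omega0) w : Prop := exists M : nat,
  forall L0 : nat, exists L j : nat,
    [/\ (L0 <= L)%N, (0 < j)%N, (j <= M.+1 ^ L)%N &
        forall k, (k < L)%N -> U (w (k + j * L)%N)].

(** The ball of radius [rho] meets a single cylinder of length comparable to
    [rho], namely between [rho / tau] and [rho / (tau A)]. *)
Lemma upper_Phi_dim_le Phi q w : 0 <= q ->
  (forall n, power_sum q (w n) <= 1) ->
  (upper_Phi_dim Phi (moran_set S w) <= q%:E)%E.
Proof.
move=> q0 wq; apply: ereal_inf_lbound; exists q => //=.
(* For rho < tau * A the scale rho / (tau * A) is at most 1, the length of the
   cylinder of generation 0. *)
exists (tau * A), ((tau * A * A)^-1 `^ q); split.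
- by rewrite mulr_gt0.
- by rewrite powR_gt0// invr_gt0 !mulr_gt0.
move=> r rho z [] + [r0 rP Prho rhoC] wz; rewrite in_itv/= => /andP[rho0 _].
have rrho : r <= rho := le_trans rP Prho.
have th : 0 < rho / (tau * A) <= 1.
  by rewrite divr_gt0 ?mulr_gt0//= ler_pdivrMr ?mulr_gt0// mul1r ltW.
have [n [f [l [C Al lth]]]] := cylinder_at_scale hS wz th.
have l0 := cylinder_gt0 hS C.
have rhol : rho <= tau * l.
  rewrite mulrC -ler_pdivrMr//; apply: le_trans Al.
  by rewrite le_eqVlt; apply/orP; left; apply/eqP; field; rewrite !gt_eqF.
have Arl : A * r <= l.
  apply: le_trans (_ : rho <= l).
    by rewrite (le_trans _ rrho)// ler_piMl ?(ltW r0)// ltW//; case/andP: A01.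
  by rewrite (le_trans rhol)// ler_piMl ?(ltW l0)// (sep_tau1 hS).
have [||L /(_ L (leqnn _))HL] := @expr_eventually_lt R B (r / l) => //.
  by rewrite divr_gt0.
have [||m [mcov mle]] := cylinder_coverable hS q0 (cyl_sim C) r0 (L := L) (w := sdrop n w) _ Arl.
- by move=> k _; exact: wq.
- by rewrite mulrC -ltr_pdivlMr.
apply: (le_trans (covering_number_le (coverableS _ mcov))).
  by move=> x [zx wx]; apply: (cyl_isolated C wx); exact: lt_le_trans zx rhol.
have c0 : 0 <= (tau * A * A)^-1 by rewrite invr_ge0 ltW// !mulr_gt0.
have rr0 : 0 <= rho / r by rewrite ltW// divr_gt0.
have lA0 : 0 <= l / (A * r) by rewrite ltW// divr_gt0// mulr_gt0.
rewrite lee_fin (le_trans mle)// -powRM//.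
apply: ge0_ler_powR; rewrite ?nnegrE ?(mulr_ge0 c0 rr0)//.
rewrite ler_pdivrMr ?mulr_gt0//; apply: le_trans (ltW lth) _.
by rewrite le_eqVlt; apply/orP; left; apply/eqP; field; rewrite !gt_eqF.
Qed.

(** The ball of radius [rho] contains a cylinder of length at least [A rho]. *)
Lemma lower_Phi_dim_ge Phi q w : 0 <= q ->
  (forall n, 1 <= power_sum q (w n)) ->
  (q%:E <= lower_Phi_dim Phi (moran_set S w))%E.
Proof.
move=> q0 wq; apply: ereal_sup_ubound; exists q => //=.
exists 1, ((tau * A / 2) `^ q); split=> //.
- by rewrite powR_gt0// divr_gt0 ?mulr_gt0.
move=> r rho z [] + [r0 rP Prho rhoC] wz; rewrite in_itv/= => /andP[rho0 rho1].
have th : 0 < rho <= 1 by rewrite rho0 ltW.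
have [n [f [l [C Al lth]]]] := cylinder_at_scale hS wz th.
have l0 := cylinder_gt0 hS C.
have tl0 : 0 < tau * l by rewrite mulr_gt0.
have [||L /(_ L (leqnn _))HL] := @expr_eventually_lt R B (r *+ 2 / (tau * l)) => //.
  by rewrite divr_gt0// mulrn_wgt0.
apply: covering_number_ge => m mcov; rewrite lee_fin.
apply: le_trans (cylinder_coverable_ge hS (w := sdrop n w) (f := f) (L := L) q0 (cyl_sim C) l0 r0 _ _ _).
- have c0 : 0 <= tau * A / 2 by rewrite ltW// divr_gt0// mulr_gt0.
  have rr0 : 0 <= rho / r by rewrite ltW// divr_gt0.
  have tlr0 : 0 <= tau * l / (r *+ 2) by rewrite ltW// divr_gt0// mulrn_wgt0.
  rewrite -powRM//; apply: ge0_ler_powR; rewrite ?nnegrE ?(mulr_ge0 c0 rr0)//.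
  rewrite ler_pdivlMr ?mulrn_wgt0//.
  apply: le_trans (_ : tau * (A * rho) <= _); last by rewrite ler_pM2l.
  by rewrite le_eqVlt; apply/orP; left; apply/eqP; field; rewrite gt_eqF.
- by move=> k _; exact: wq.
- by rewrite mulrC -ler_pdivlMr// ltW.
apply: coverableS mcov => x fx; split; last exact: cyl_sub C _ fx.
move: (cyl_mem C) fx => [y /moran_set01 y01 <-] [y' /moran_set01 y'01 <-].
rewrite /ball/= (proj2 (cyl_sim C))//; apply: le_lt_trans lth.
by rewrite ler_piMr ?(ltW l0)// dist01_le1.
Qed.

(** A ball of radius [2 l] contains the cylinder of length [l] in which a run
    starts.  At [r = l B^L] a run of length [L] forces at least a constant times
    [B^(- L q)] balls, while an exponent [s < q] would allow only a constant times
    [B^(- L s)]. *)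
Lemma upper_Phi_dim_ge Phi q w : 0 <= q -> small_dimension_function Phi ->
  log_runs [set v | 1 <= power_sum q v] w ->
  (q%:E <= upper_Phi_dim Phi (moran_set S w))%E.
Proof.
move=> q0 small [M runs]; apply/ereal_infP => _ [s [C1 [C2 [C10 C20 Hs]]] <-].
rewrite lee_fin leNgt; apply/negP => sq.
have [|||||L1 HL1] := @powR_growth R B C2 2 (tau / 2) s q => //.
  by rewrite divr_gt0.
have [||L2 HL2] := @run_scales_admissible R Phi A B C1 2 2^-1 M small A01 B01 C10 => //.
have [L [j [LL j0 jM run]]] := runs (maxn L1 L2).
move: LL; rewrite geq_max => /andP[/HL1 growth LL2].
set n := (j * L)%N in run.
have [z wz] := moran_set_neq0 hS w.
have [f [l C]] := cylinder_exists hS n wz.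
have l0 := cylinder_gt0 hS C.
have BL0 : 0 < B ^+ L by rewrite exprn_gt0.
have adm := HL2 L n l LL2 (leq_pmull _ j0) (leq_mul jM (leqnn L)).
rewrite (cyl_ge C) (cyl_le C) in adm; move/(_ isT) in adm.
set r := 2^-1 * B ^+ L * (2 * l) in adm.
have rE : r = l * B ^+ L by rewrite /r; field.
have r0 : 0 < r by rewrite rE mulr_gt0.
have := Hs r (2 * l) z adm wz.
apply/negP; rewrite -ltNge.
apply: lt_le_trans (_ : (((tau / 2) / B ^+ L) `^ q)%:E <= _)%E.
  rewrite lte_fin; apply: le_lt_trans growth.
  rewrite ler_pM2l// (_ : 2 * l / r = 2 / B ^+ L)// rE.
  by field; rewrite !gt_eqF.
apply: covering_number_ge => m mcov; rewrite lee_fin.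
rewrite (_ : _ / B ^+ L = tau * l / (r *+ 2)); last first.
  by rewrite rE; field; rewrite !gt_eqF.
apply: (cylinder_coverable_ge hS (w := sdrop n w) (f := f) (L := L) q0 (cyl_sim C) l0 r0).
- by move=> k kL; exact: run.
- rewrite rE -mulrA -mulr_natl ler_pM2r ?mulr_gt0//.
  by rewrite (le_trans (sep_tau1 hS))// ler1n.
apply: coverableS mcov => x fx; split; last exact: cyl_sub C _ fx.
move: (cyl_mem C) fx => [y /moran_set01 y01 <-] [y' /moran_set01 y'01 <-].
rewrite /ball/= (proj2 (cyl_sim C))//; apply: (@le_lt_trans _ _ l).
  by rewrite ler_piMr ?(ltW l0)// dist01_le1.
by rewrite ltr_pMl// ltr1n.
Qed.

(** Dually, a ball of radius [tau l] meets only the cylinder of length [l] in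
    which the run starts, and at [r = 2 l B^L] every interval left after the [L]
    subdivisions of the run is shorter than [r]. *)
Lemma lower_Phi_dim_le Phi q w : 0 <= q -> small_dimension_function Phi ->
  log_runs [set v | power_sum q v <= 1] w ->
  (lower_Phi_dim Phi (moran_set S w) <= q%:E)%E.
Proof.
move=> q0 small [M runs]; apply/ereal_supP => _ [s [C1 [C2 [C10 C20 Hs]]] <-].
rewrite lee_fin leNgt; apply/negP => qs.
have [|||||L1 HL1] := @powR_growth R B C2^-1 (A *+ 2)^-1 (tau / 2) q s => //.
- by rewrite invr_gt0.
- by rewrite invr_gt0 mulrn_wgt0.
- by rewrite divr_gt0.
have [||L2 HL2] := @run_scales_admissible R Phi A B C1 tau (2 / tau) M small A01 B01 C10 => //.
  by rewrite divr_gt0.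
have [L [j [LL j0 jM run]]] := runs (maxn L1 L2).
move: LL; rewrite geq_max => /andP[/HL1 growth LL2].
set n := (j * L)%N in run.
have [z wz] := moran_set_neq0 hS w.
have [f [l C]] := cylinder_exists hS n wz.
have l0 := cylinder_gt0 hS C.
have BL0 : 0 < B ^+ L by rewrite exprn_gt0.
have BL1 : B ^+ L <= 1 by rewrite exprn_ile1// ltW// (sep_B hS).
have adm := HL2 L n l LL2 (leq_pmull _ j0) (leq_mul jM (leqnn L)).
rewrite (cyl_ge C) (cyl_le C) in adm; move/(_ isT) in adm.
set r := 2 / tau * B ^+ L * (tau * l) in adm.
have rE : r = l * (2 * B ^+ L) by rewrite /r; field; rewrite gt_eqF.
have r0 : 0 < r by rewrite rE !mulr_gt0.
have Arl : A * r <= l.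
  rewrite rE mulrCA ler_piMr ?(ltW l0)//.
  apply: (@le_trans _ _ (2^-1 * (2 * B ^+ L))); last by rewrite mulKf.
  by rewrite ler_pM2r ?mulr_gt0// (sep_A2 hS).
have [||m [mcov mle]] := cylinder_coverable hS q0 (cyl_sim C) r0 (L := L) (w := sdrop n w) _ Arl.
- by move=> k kL; exact: run.
- by rewrite rE ltr_pM2l// ltr_pMl// ltr1n.
have := Hs r (tau * l) z adm wz.
apply/negP; rewrite -ltNge.
apply: (le_lt_trans (covering_number_le (coverableS _ mcov))).
  by move=> x [zx wx]; exact: (cyl_isolated C wx).
rewrite lte_fin; apply: (le_lt_trans mle).
rewrite -ltr_pdivrMl// (_ : tau * l / r = (tau / 2) / B ^+ L); last first.
  by rewrite rE; field; rewrite !gt_eqF.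
rewrite (_ : l / (A * r) = (A *+ 2)^-1 / B ^+ L)//.
by rewrite rE; field; rewrite !gt_eqF ?mulrn_wgt0.
Qed.

End realisations.

(** * Almost sure events *)

Section probability_lemmas.
Context {d : measure_display} {T : measurableType d} {R : realType}.
Variable Q : probability T R.
Implicit Types (E : nat -> set T).

Lemma ae_bigcap E : (forall n, measurable (E n)) -> (forall n, Q (E n) = 1%E) ->
  Q (\bigcap_n E n) = 1%E.
Proof.
move=> mE QE; have mCE n : measurable (~` E n) by exact: measurableC.
have mU : measurable (\bigcup_n ~` E n) by exact: bigcupT_measurable.
rewrite -[X in Q X]setCK setC_bigcap probability_setC//.
have -> : Q (\bigcup_n ~` E n) = 0%E; last by rewrite sube0.
apply/negligibleP => //; apply: negligible_bigcup => n.
by apply/negligibleP => //; have := probability_setC Q (mE n); rewrite QE subee.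
Qed.

Definition all_in E (s : seq nat) : set T := [set w | forall j, j \in s -> E j w].
Definition none_in E (s : seq nat) : set T := [set w | forall j, j \in s -> ~ E j w].

Lemma all_in_cons E j s : all_in E (j :: s) = E j `&` all_in E s.
Proof.
apply/seteqP; split=> [w jsw|w [jw sw] i]; last by rewrite inE => /predU1P[->|/sw].
by split=> [|i si]; apply: jsw; rewrite inE ?eqxx// si orbT.
Qed.

Lemma all_in_nil E : all_in E [::] = setT. Proof. exact/seteqP. Qed.

Lemma none_inE E s : none_in E s = all_in (fun j => ~` E j) s.
Proof. by []. Qed.

Lemma measurable_all_in E s : (forall n, measurable (E n)) ->
  measurable (all_in E s).
Proof.
move=> mE; elim: s => [|j s IH]; first by rewrite all_in_nil; exact: measurableT.
by rewrite all_in_cons; exact: measurableI.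
Qed.

Lemma measurable_none_in E s : (forall n, measurable (E n)) ->
  measurable (none_in E s).
Proof. by move=> mE; apply: measurable_all_in => n; exact: measurableC. Qed.

(** Independence passes to complements, one event at a time:
    [Q (X minus E_j) = Q X - Q (X cap E_j)]. *)
Lemma independent_complements E (p : R) : (forall n, measurable (E n)) ->
  (forall t, uniq t -> Q (all_in E t) = (p ^+ size t)%:E) ->
  forall s t, uniq (s ++ t) ->
  Q (none_in E s `&` all_in E t) = ((1 - p) ^+ size s * p ^+ size t)%:E.
Proof.
move=> mE Et; elim=> [|j s IH] t /= ust.
  by rewrite none_inE all_in_nil setTI mul1r Et.
move: ust; rewrite mem_cat negb_or => /andP[/andP[js jt] ust].
have mX : measurable (none_in E s `&` all_in E t).
  by apply: measurableI; [exact: measurable_none_in|exact: measurable_all_in].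
have -> : none_in E (j :: s) `&` all_in E t = (none_in E s `&` all_in E t) `\` E j.
  by rewrite !none_inE all_in_cons -setIA setIC setDE.
have IHt := IH t ust; have ujt : uniq (s ++ j :: t).
  by rewrite -cat_rcons -cats1 -catA uniq_catCA /= mem_cat negb_or js jt.
have IHjt := IH _ ujt.
rewrite measureD// ?(le_lt_trans (probability_le1 _ _)) ?ltry//.
rewrite -setIA (setIC (all_in E t)) -all_in_cons.
rewrite [X in (X - _)%E]IHt [X in (_ - X)%E]IHjt.
by rewrite -EFinB; congr _%:E; rewrite /= !exprS; ring.
Qed.

End probability_lemmas.

Section typical_sequences.
Context {R : realType} {d0 : measure_display} {Omega0 : measurableType d0}.
Variables (P : probability Omega0 R).
Variable PP : probability (@sequence_space d0 Omega0) R.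
Hypothesis hPP : is_infinite_product P PP.
Implicit Types (U : set Omega0).

Definition at_time U (n : nat) : set (@sequence_space d0 Omega0) :=
  [set w | U (w n)].

Lemma measurable_at_time U n : measurable U -> measurable (at_time U n).
Proof. by move=> mU; apply: sub_sigma_algebra; exists n, U. Qed.

Lemma PP_at_times U (t : seq nat) : measurable U -> uniq t ->
  PP (all_in (at_time U) t) = ((fine (P U)) ^+ size t)%:E.
Proof.
move=> mU ut; set p := fine (P U).
have PUE : P U = p%:E by rewrite fineK// fin_num_measure.
pose n := (\max_(k <- t) k).+1.
have tn k : k \in t -> (k < n)%N.
  by move=> kt; rewrite ltnS; apply: leq_bigmax_seq.
(* A finite set of constrained times is a rectangle over an initial segment. *)
pose V (k : 'I_n) := if (k : nat) \in t then U else setT.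
have mV k : measurable (V k) by rewrite /V; case: ifP => // _; exact: measurableT.
have -> : all_in (at_time U) t =
    [set w : nat -> Omega0 | forall k : 'I_n, V k (w k)].
  apply/seteqP; split=> [w tw k|w Vw k kt].
    by rewrite /V; case: ifPn => // kt; exact: tw.
  by have := Vw (Ordinal (tn k kt)); rewrite /V /= kt.
rewrite hPP//.
under eq_bigr => k _.
  rewrite (_ : P (V k) = (if (k : nat) \in t then p else 1)%:E); last first.
    by rewrite /V; case: ifP => _; rewrite ?PUE ?probability_setT.
  over.
rewrite prodEFin -(big_mkord xpredT (fun k => if k \in t then p else 1)).
rewrite -big_mkcond -big_filter (perm_big t).
  by rewrite big_const_seq count_predT iter_mulr_1.
apply: uniq_perm => //; first by rewrite filter_uniq// iota_uniq.
move=> k; rewrite mem_filter mem_index_iota /=.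
by apply/andP/idP => [[]//|kt]; rewrite kt tn.
Qed.

Definition run_at U (L j : nat) : set (@sequence_space d0 Omega0) :=
  all_in (at_time U) [seq (k + j * L)%N | k <- iota 0 L].

Lemma measurable_run_at U L j : measurable U -> measurable (run_at U L j).
Proof. by move=> mU; apply: measurable_all_in => n; exact: measurable_at_time. Qed.

Lemma PP_runs U L (t : seq nat) : measurable U -> uniq t ->
  PP (all_in (run_at U L) t) = (((fine (P U)) ^+ L) ^+ size t)%:E.
Proof.
move=> mU ut.
pose times := [seq (k + j * L)%N | j <- t, k <- iota 0 L].
have -> : all_in (run_at U L) t = all_in (at_time U) times.
  apply/seteqP; split=> w tw.
    move=> _ /allpairsP[[j k] [/= jt kL ->]].
    by apply: (tw j jt); exact: map_f.
  by move=> j jt _ /mapP[k kL ->]; apply: tw; apply/allpairsP; exists (j, k).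
rewrite PP_at_times//.
  by rewrite size_allpairs size_iota mulnC exprM.
apply: allpairs_uniq => //; first exact: iota_uniq.
move=> _ _ /allpairsP[[j k] [/= _ + ->]] /allpairsP[[j' k'] [/= _ + ->]].
rewrite !mem_iota !add0n /= => kL k'L E.
have L0 : (0 < L)%N by exact: leq_ltn_trans kL.
have jj' : j = j'.
  by have := congr1 (divn^~ L) E; rewrite /= !divnDMl// !divn_small.
by move: E; rewrite jj' => /addIn ->.
Qed.

(** The blocks are numbered from 1, so that the [j]-th one starts at a time
    [j L >= L]: late runs are runs at small scales. *)
Definition no_runs U M L : set (@sequence_space d0 Omega0) :=
  none_in (run_at U L) (iota 1 (M.+1 ^ L)).

Lemma measurable_no_runs U M L : measurable U -> measurable (no_runs U M L).
Proof. by move=> mU; apply: measurable_none_in => j; exact: measurable_run_at. Qed.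

(** There are [(M+1)^L] independent blocks, each a run with probability [p^L];
    since [(M+1) p >= 2] the expected number of runs is at least [2^L]. *)
Lemma PP_no_runs U M L : measurable U -> 2 <= M.+1%:R * fine (P U) ->
  (PP (no_runs U M L) <= (expR (-1) ^+ L)%:E)%E.
Proof.
move=> mU Mp; set p := fine (P U) in Mp.
have p1 : p <= 1.
  by rewrite -lee_fin fineK ?fin_num_measure// probability_le1.
have p0 : 0 <= p by rewrite fine_ge0.
have mR n : measurable (run_at U L n) by exact: measurable_run_at.
have := @independent_complements _ _ _ PP _ _ mR (fun t => @PP_runs U L t mU)
  (iota 1 (M.+1 ^ L)) [::].
rewrite cats0 iota_uniq all_in_nil setIT -/p size_iota mulr1 => /(_ isT) ->.
rewrite lee_fin.
apply: (@le_trans _ _ (expR (- p ^+ L) ^+ (M.+1 ^ L))).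
  by rewrite lerXn2r ?nnegrE ?expR_ge0// ?subr_ge0 ?exprn_ile1// expR_ge1Dx.
rewrite -!expRM_natl ler_expR mulrN mulrN1 lerN2 natrX -exprMn.
apply: (@le_trans _ _ (2 ^+ L)).
  by rewrite -natrX ler_nat ltnW// ltn_expl.
by rewrite lerXn2r ?nnegrE// mulr_ge0.
Qed.

(** With [M + 1 >= 2 / p], having no run for any [L >= L0] is less likely than
    [exp(- L)] for each such [L], hence has probability 0. *)
Lemma ae_log_runs U : measurable U -> (0 < P U)%E ->
  exists G : set (@sequence_space d0 Omega0),
    [/\ measurable G, PP G = 1%E & forall w, G w -> log_runs U w].
Proof.
move=> mU PU; set p := fine (P U).
have p0 : 0 < p by rewrite fine_gt0// PU ltey_eq fin_num_measure.
pose M := Num.bound (2 / p).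
have Mp : 2 <= M.+1%:R * p.
  rewrite -ler_pdivrMr// ltW//; apply: lt_trans (archi_boundP _) _.
    by rewrite divr_ge0// ltW.
  by rewrite ltr_nat.
pose N L0 := \bigcap_(L in [set L | (L0 <= L)%N]) no_runs U M L.
have mN L0 : measurable (N L0).
  by apply: bigcap_measurable => [|L _]; [exists L0 => /=|exact: measurable_no_runs].
exists (\bigcap_L0 ~` N L0); split.
- by apply: bigcapT_measurable => L0; exact: measurableC.
- apply: ae_bigcap => L0; first exact: measurableC.
  rewrite probability_setC//; suff -> : PP (N L0) = 0%E by rewrite sube0.
  apply/eqP; rewrite eq_le measure_ge0 andbT; apply/lee_addgt0Pr => e e0.
  have [|L1 HL1] := @expr_eventually_lt R (expR (-1)) e _ e0.
    by rewrite expR_gt0 expR_lt1 ltrN10.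
  rewrite add0e; apply: (@le_trans _ _ (PP (no_runs U M (maxn L0 L1)))).
    apply: le_measure; rewrite ?inE//; first exact: measurable_no_runs.
    by move=> w /(_ (maxn L0 L1) (leq_maxl _ _)).
  apply: (le_trans (PP_no_runs _ mU Mp)).
  by rewrite lee_fin ltW// HL1// leq_maxr.
- move=> w Gw; exists M => L0; have /existsNP[L /not_implyP[LL0]] := Gw L0 I.
  move=> /existsNP[j /not_implyP[jM /contrapT jw]].
  move: jM; rewrite mem_iota add1n ltnS => /andP[j0 jM].
  exists L, j; split=> // k kL; apply: (jw (k + j * L)%N); apply: map_f.
  by rewrite mem_iota.
Qed.

Lemma ae_always U : measurable U -> P U = 1%E ->
  exists G : set (@sequence_space d0 Omega0),
    [/\ measurable G, PP G = 1%E & forall w, G w -> forall n, U (w n)].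
Proof.
move=> mU PU; exists (\bigcap_n at_time U n); split.
- by apply: bigcapT_measurable => n; exact: measurable_at_time.
- apply: ae_bigcap => n; first exact: measurable_at_time.
  have := @PP_at_times U [:: n] mU isT.
  rewrite all_in_cons all_in_nil setIT => ->.
  by rewrite PU expr1.
- by move=> w Gw n; exact: Gw.
Qed.

Lemma typical_sequences (W : nat -> set Omega0) : (forall i, measurable (W i)) ->
  exists G : set (@sequence_space d0 Omega0),
    [/\ measurable G, PP G = 1%E & forall w, G w -> forall i,
      (P (W i) = 1%E -> forall n, W i (w n)) /\
      ((0 < P (W i))%E -> log_runs (W i) w)].
Proof.
move=> mW.
have /choice[G GP] : forall i, exists G : set (@sequence_space d0 Omega0),
    [/\ measurable G, PP G = 1%E & forall w, G w ->
      (P (W i) = 1%E -> forall n, W i (w n)) /\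
      ((0 < P (W i))%E -> log_runs (W i) w)].
  move=> i; have [G1 [mG1 PG1 HG1]] : exists G : set (@sequence_space d0 Omega0),
      [/\ measurable G, PP G = 1%E & forall w, G w ->
        P (W i) = 1%E -> forall n, W i (w n)].
    have [W1|W1] := pselect (P (W i) = 1%E).
      by have [G [mG PG HG]] := ae_always (mW i) W1; exists G; split=> // w /HG.
    by exists setT; split; rewrite ?probability_setT//; exact: measurableT.
  have [G2 [mG2 PG2 HG2]] : exists G : set (@sequence_space d0 Omega0),
      [/\ measurable G, PP G = 1%E & forall w, G w ->
        (0 < P (W i))%E -> log_runs (W i) w].
    have [W0|W0] := pselect (0 < P (W i))%E.
      by have [G [mG PG HG]] := ae_log_runs (mW i) W0; exists G; split=> // w /HG.
    by exists setT; split; rewrite ?probability_setT//; exact: measurableT.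
  exists (\bigcap_n (if n is 0%N then G1 else G2)); split.
  - by apply: bigcapT_measurable => -[].
  - by apply: ae_bigcap => -[].
  - by move=> w Gw; split; [apply: HG1; exact: (Gw 0%N)|apply: HG2; exact: (Gw 1%N)].
exists (\bigcap_i G i); split.
- by apply: bigcapT_measurable => i; have [] := GP i.
- by apply: ae_bigcap => i; have [] := GP i.
- by move=> w Gw i; have [_ _] := GP i; apply; exact: Gw.
Qed.

End typical_sequences.

(** * The similarity dimension and its essential bounds *)

Section similarity_dimension.
Context {R : realType} {K : nat}.
Implicit Types (c : 'I_K -> R) (q s : R).

Let psum c s := \sum_j c j `^ s.

Lemma psum_nonincreasing c q s : (forall j, 0 < c j < 1) -> q <= s ->
  psum c s <= psum c q.
Proof.
move=> c01 qs; apply: ler_sum => j _; apply: ger_powR => //.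
by have /andP[-> /ltW] := c01 j.
Qed.

Lemma psum_decreasing c q s : (0 < K)%N -> (forall j, 0 < c j < 1) -> q < s ->
  psum c s < psum c q.
Proof.
move=> K0 c01 qs; apply: ltr_sum => [|j _].
  by apply/hasP; exists (Ordinal K0) => //; exact: mem_index_enum.
have /andP[cj0 cj1] := c01 j.
rewrite /powR gt_eqF// ltr_expR ltr_nM2r//.
by rewrite ln_lt0// cj0.
Qed.

Lemma psum_continuous c : (forall j, 0 < c j) -> continuous (psum c).
Proof.
move=> c0; rewrite (_ : psum c = \sum_j (fun s => c j `^ s)); last first.
  by apply/funext => s; rewrite fct_sumE.
apply: (big_ind (fun f : R -> R => continuous f)).
- by move=> x; exact: cst_continuous.
- by move=> f g fc gc x; apply: continuousD; [exact: fc|exact: gc].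
move=> j _ x; rewrite /powR gt_eqF//.
apply: (@continuous_comp _ _ _ (fun s : R => s * ln (c j)) expR).
  exact: mulrr_continuous.
exact: continuous_expR.
Qed.

(** The power sum is [K >= 1] at the exponent 0 and less than 1 at the exponent
    1, so the equation has a solution between 0 and 1. *)
Lemma similarity_dimP c : (0 < K)%N -> (forall j, 0 < c j < 1) ->
  \sum_j c j <= 1 -> 0 <= similarity_dim c /\ psum c (similarity_dim c) = 1.
Proof.
move=> K0 c01 c1; rewrite /similarity_dim.
apply: (xgetPex 0 (P := [set s | 0 <= s /\ psum c s = 1])).
have p0 : 1 <= psum c 0.
  rewrite /psum; under eq_bigr do rewrite powRr0.
  by rewrite sumr_const card_ord ler1n.
have p1 : psum c 1 <= 1.
  rewrite /psum (eq_bigr c)// => j _.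
  by rewrite powRr1// ltW//; case/andP: (c01 j).
have [|||s + ps] := @IVT R (psum c) 0 1 1 => //.
- apply: continuous_subspaceT; apply: psum_continuous => j.
  by case/andP: (c01 j).
- by rewrite ge_min p1 orbT le_max p0.
by rewrite in_itv/= => /andP[s0 _]; exists s.
Qed.

Lemma similarity_dim_le c q : (0 < K)%N -> (forall j, 0 < c j < 1) ->
  \sum_j c j <= 1 -> (similarity_dim c <= q) = (psum c q <= 1).
Proof.
move=> K0 c01 c1; have [_ ps] := similarity_dimP K0 c01 c1.
apply/idP/idP => [/(psum_nonincreasing c01)|]; first by rewrite ps.
apply: contraTT; rewrite -!ltNge => /(psum_decreasing K0 c01).
by rewrite ps.
Qed.

Lemma similarity_dim_ge c q : (0 < K)%N -> (forall j, 0 < c j < 1) ->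
  \sum_j c j <= 1 -> (q <= similarity_dim c) = (1 <= psum c q).
Proof.
move=> K0 c01 c1; have [_ ps] := similarity_dimP K0 c01 c1.
apply/idP/idP => [/(psum_nonincreasing c01)|]; first by rewrite ps.
apply: contraTT; rewrite -!ltNge => /(psum_decreasing K0 c01).
by rewrite ps.
Qed.

End similarity_dimension.

Section essential_bounds.
Context {d : measure_display} {T : measurableType d} {R : realType}.
Variable Q : probability T R.
Implicit Types (f : T -> R) (q : R).

Lemma ae_probability1 (E : set T) : measurable E ->
  (\forall x \ae Q, E x) -> Q E = 1%E.
Proof.
move=> mE /(negligibleP _ (measurableC mE)) QE.
by rewrite -[E]setCK probability_setC ?QE ?sube0//; exact: measurableC.
Qed.

Lemma probability_gt0 (E : set T) : measurable E ->
  ~ (\forall x \ae Q, ~ E x) -> (0 < Q E)%E.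
Proof.
move=> mE notae; rewrite lt0e measure_ge0 andbT; apply/eqP => QE.
apply: notae; exists E; split=> // x /contrapT; exact.
Qed.

Lemma probability_le_ess_sup f q : measurable [set v | (f v <= q)%R] ->
  (ess_sup Q (fun v => (f v)%:E) < q%:E)%E -> Q [set v | (f v <= q)%R] = 1%E.
Proof.
move=> mE /ltW fq; apply: ae_probability1 => //.
by move/ess_supP : fq; apply: filterS => v; rewrite lee_fin.
Qed.

Lemma probability_ge_ess_sup f q : measurable [set v | (q <= f v)%R] ->
  (q%:E < ess_sup Q (fun v => (f v)%:E))%E -> (0 < Q [set v | (q <= f v)%R])%E.
Proof.
move=> mE qf; apply: probability_gt0 => // fq.
move: qf; rewrite ltNge => /negP; apply; apply/ess_supP.
by apply: filterS fq => v /= /negP; rewrite -ltNge lee_fin => /ltW.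
Qed.

Lemma probability_ge_ess_inf f q : measurable [set v | (q <= f v)%R] ->
  (q%:E < ess_inf Q (fun v => (f v)%:E))%E -> Q [set v | (q <= f v)%R] = 1%E.
Proof.
move=> mE /ltW fq; apply: ae_probability1 => //.
by move/ess_infP : fq; apply: filterS => v; rewrite lee_fin.
Qed.

Lemma probability_le_ess_inf f q : measurable [set v | (f v <= q)%R] ->
  (ess_inf Q (fun v => (f v)%:E) < q%:E)%E -> (0 < Q [set v | (f v <= q)%R])%E.
Proof.
move=> mE qf; apply: probability_gt0 => // fq.
move: qf; rewrite ltNge => /negP; apply; apply/ess_infP.
by apply: filterS fq => v /= /negP; rewrite -ltNge lee_fin => /ltW.
Qed.

Lemma ess_sup_ge0 f : (forall v, 0 <= f v) ->
  (0 <= ess_sup Q (fun v => (f v)%:E))%E.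
Proof.
move=> f0; apply: ess_sup_gee.
  rewrite [ltRHS](_ : _ = 1%E) ?lte01//; exact: probability_setT.
by apply: nearW => v; rewrite lee_fin.
Qed.

Lemma ess_inf_ge0 f : (forall v, 0 <= f v) ->
  (0 <= ess_inf Q (fun v => (f v)%:E))%E.
Proof. by move=> f0; apply/ess_infP; apply: nearW => v; rewrite lee_fin. Qed.

End essential_bounds.

Section rational_bounds.
Context {R : realType}.
Implicit Types x y : \bar R.

Lemma lte_rat_between x y : (x < y)%E ->
  exists q : rat, (x < (ratr q)%:E < y)%E.
Proof.
have real_between (r s : R) : r < s -> exists q : rat, r < ratr q < s.
  by move=> /rat_in_itvoo[q]; rewrite in_itv/= => ?; exists q.
case: x => [r||]; case: y => [s||] //=; rewrite ?lte_fin.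
- by move=> /real_between[q]; exists q; rewrite !lte_fin.
- move=> _; have [|q /andP[rq _]] := @real_between r (r + 1); first by rewrite ltrDl.
  by exists q; rewrite lte_fin rq ltry.
- move=> _; have [|q /andP[_ qs]] := @real_between (s - 1) s.
    by rewrite ltrBlDr ltrDl.
  by exists q; rewrite lte_fin qs ltNyr.
- by move=> _; exists 0; rewrite ltNyr ltry.
Qed.

Lemma lee_rat_above x y :
  (forall q : rat, (x < (ratr q)%:E)%E -> (y <= (ratr q)%:E)%E) -> (y <= x)%E.
Proof.
move=> H; rewrite leNgt; apply/negP => /lte_rat_between[q /andP[/H yq]].
by rewrite ltNge yq.
Qed.

Lemma lee_rat_below x y :
  (forall q : rat, ((ratr q)%:E < y)%E -> ((ratr q)%:E <= x)%E) -> (y <= x)%E.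
Proof.
move=> H; rewrite leNgt; apply/negP => /lte_rat_between[q /andP[xq /H]].
by rewrite leNgt xq.
Qed.

End rational_bounds.

(** * From the random system to its geometry *)

Lemma separated_ifs_of_random {R : realType} {d0 : measure_display}
    {Omega0 : measurableType d0} {P : probability Omega0 R} {K : nat}
    {A B tau : R} {S : Omega0 -> 'I_K -> R -> R} {a p : 'I_K -> {RV P >-> R}} :
  (2 <= K)%N -> 0 < A -> 0 < tau -> K%:R * A <= B -> 0 < B -> B < 1 ->
  tau <= (1 - B) / K%:R -> random_weighted_ifs A B tau S a p ->
  separated_ifs A B tau S (fun j v => a j v).
Proof.
move=> hK hA htau hAB hB hB1 htauB [Sself Ssim Alo asum aup Ssep _ _ _].
have K2 : 2 <= K%:R :> R by rewrite ler_nat.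
have K0 : 0 < K%:R :> R by rewrite (lt_le_trans _ K2).
split=> //; first exact: leq_trans hK.
- rewrite -[leRHS]mul1r ler_pdivlMr// mulrC; apply: le_trans (ltW hB1).
  by apply: le_trans hAB; rewrite ler_pM2r.
- apply: (le_trans htauB); rewrite ler_pdivrMr// mul1r.
  by rewrite lerBlDr (le_trans _ (lerD K2 (ltW hB)))// addr0 ler1n.
- move=> v j; split; last exact: Ssim.
  by move=> x x01; apply: (Sself v j); exists x.
- by move=> v j; exact: le_trans (asum v j) (aup v).
- move=> v i j x y ij x01 y01; apply: le_trans (Ssep v i j ij) _.
  apply: ge_inf; first by exists 0 => _ [? _ [? _ <-]].
  by exists (S v i x); [exists x|exists (S v j y); [exists y|]].
Qed.

(** * The dimensions of almost every realisation *)

Theorem theorem6 (R : realType) (d0 : measure_display)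
    (Omega0 : measurableType d0) (P : probability Omega0 R)
    (PP : probability (@sequence_space d0 Omega0) R)
    (K : nat) (A B tau : R) (S : Omega0 -> 'I_K -> R -> R)
    (a p : 'I_K -> {RV P >-> R})
    (hPP : is_infinite_product P PP)
    (hK : (2 <= K)%N)
    (hA : 0 < A) (hB : 0 < B) (htau : 0 < tau)
    (hKA : 0 < K%:R * A) (hAB : K%:R * A <= B) (hB1 : B < 1)
    (htauB : tau <= (1 - B) / K%:R)
    (hS : random_weighted_ifs A B tau S a p) :
  exists Gamma : set (@sequence_space d0 Omega0),
    [/\ measurable Gamma, PP Gamma = 1%E &
      forall w, Gamma w -> forall Phi : R -> R, small_dimension_function Phi ->
        upper_Phi_dim Phi (moran_set S w)
          = ess_sup P (fun v => (similarity_dim (fun j => a j v))%:E) /\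
        lower_Phi_dim Phi (moran_set S w)
          = ess_inf P (fun v => (similarity_dim (fun j => a j v))%:E)].
Proof.
have sepS := separated_ifs_of_random hK hA htau hAB hB hB1 htauB hS.
have K0 : (0 < K)%N := leq_trans (ltnSn 1 : 0 < 2)%N hK.
pose aa (j : 'I_K) (v : Omega0) : R := a j v.
have a01 v j : 0 < aa j v < 1.
  by rewrite (sep_a_gt0 sepS) (le_lt_trans (sep_upper sepS v j)).
have a1 v : \sum_j aa j v <= 1 by rewrite (le_trans (wifs_upper hS v))// ltW.
pose dim v := similarity_dim (fun j => aa j v).
have dim0 v : 0 <= dim v by have [] := similarity_dimP K0 (a01 v) (a1 v).
have dim_le q : [set v | dim v <= q] = [set v | power_sum aa q v <= 1].
  by apply/seteqP; split=> v /=; rewrite /dim (similarity_dim_le _ K0 (a01 v) (a1 v)).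
have dim_ge q : [set v | q <= dim v] = [set v | 1 <= power_sum aa q v].
  by apply/seteqP; split=> v /=; rewrite /dim (similarity_dim_ge _ K0 (a01 v) (a1 v)).
have mpower q : measurable_fun setT (power_sum aa q).
  apply: measurable_sum => j.
  exact: (measurableT_comp (measurable_realfun.measurable_powR q)).
have m_le q : measurable [set v | dim v <= q].
  by rewrite dim_le -[X in measurable X]setTI; apply: measurable_fun_le.
have m_ge q : measurable [set v | q <= dim v].
  by rewrite dim_ge -[X in measurable X]setTI; apply: measurable_fun_le.
(* Upper and lower level sets of the similarity dimension at all rational
   levels, in one sequence. *)
pose W i := if (unpickle i : option (bool * rat)) is Some (b, q)
  then if b then [set v | dim v <= ratr q] else [set v | ratr q <= dim v]
  else setT.
have mW i : measurable (W i).
  by rewrite /W; case: unpickle => [[[] q]|] //; exact: measurableT.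
have [G [mG PG HG]] := typical_sequences hPP mW.
exists G; split=> // w Gw Phi small.
have le_typical (q : rat) :
    (P [set v | (dim v <= ratr q)%R] = 1%E -> forall n, power_sum aa (ratr q) (w n) <= 1) /\
    ((0 < P [set v | (dim v <= ratr q)%R])%E ->
       log_runs [set v | power_sum aa (ratr q) v <= 1] w).
  have := HG w Gw (pickle (true, q)); rewrite /W pickleK.
  by rewrite dim_le.
have ge_typical (q : rat) :
    (P [set v | (ratr q <= dim v)%R] = 1%E -> forall n, 1 <= power_sum aa (ratr q) (w n)) /\
    ((0 < P [set v | (ratr q <= dim v)%R])%E ->
       log_runs [set v | 1 <= power_sum aa (ratr q) v] w).
  have := HG w Gw (pickle (false, q)); rewrite /W pickleK.
  by rewrite dim_ge.
have P0 : P [set v | (ratr 0 <= dim v)%R] = 1%E.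
  rewrite (_ : [set v | _] = setT) ?probability_setT//.
  by apply/seteqP; split=> v //= _; rewrite rmorph0.
split; apply/eqP; rewrite eq_le; apply/andP; split.
- apply: lee_rat_above => q Dq.
  have q0 : 0 <= ratr q :> R.
    by rewrite -lee_fin (le_trans _ (ltW Dq))// ess_sup_ge0.
  apply: (upper_Phi_dim_le sepS) => //; apply: (le_typical q).1.
  exact: probability_le_ess_sup.
- apply: lee_rat_below => q qD; have [q0|q0] := leP 0 q.
    apply: (upper_Phi_dim_ge sepS) => //; first by rewrite ler0q.
    by apply: (ge_typical q).2; exact: probability_ge_ess_sup.
  (* The counting bounds need a nonnegative exponent; 0 is always typical. *)
  apply: (@le_trans _ _ (ratr 0)%:E); first by rewrite lee_fin ler_rat ltW.
  apply: (upper_Phi_dim_ge sepS) => //; first by rewrite rmorph0.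
  by apply: (ge_typical 0).2; rewrite P0.
- apply: lee_rat_above => q dq.
  have q0 : 0 <= ratr q :> R.
    by rewrite -lee_fin (le_trans _ (ltW dq))// ess_inf_ge0.
  apply: (lower_Phi_dim_le sepS) => //; apply: (le_typical q).2.
  exact: probability_le_ess_inf.
- apply: lee_rat_below => q qd; have [q0|q0] := leP 0 q.
    apply: (lower_Phi_dim_ge sepS) => //; first by rewrite ler0q.
    by apply: (ge_typical q).1; exact: probability_ge_ess_inf.
  apply: (@le_trans _ _ (ratr 0)%:E); first by rewrite lee_fin ler_rat ltW.
  apply: (lower_Phi_dim_ge sepS) => //; first by rewrite rmorph0.
  by apply: (ge_typical 0).1.
Qed.
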